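(* Let $p$ be a prime, $k\in\mathbb{N}$, $b\in[p-1]$ and $\mathsf{u}\in\{0,1\}^k$. Suppose $l_1,l_2,\dots,l_b$ are integers such that $1\le l_1<l_2<\cdots<l_b\le k$. Then $$\Gamma_{l_1,l_2,\dots,l_b;k}(\mathsf{u}) = p^k\cdot C_{l_1}(\mathsf{u})\cdots C_{l_b}(\mathsf{u})\cdot R^{[b]}_k,$$ where $R^{[b]}_k=(p^k-p^{l_b})(p^k-p^{l_b}-p^{l_{b-1}})\cdots(p^k-p^{l_b}-p^{l_{b-1}}-\cdots-p^{l_2})$ if $b\ge 2$, and $R^{[1]}_k=1$.
   Context: $[m]=\{1,\dots,m\}$; $\mathfrak{S}_n$ is the symmetric group on $[n]$; characters are complex. Sylow subgroups: $P_p\le\mathfrak{S}_p$ is cyclic of order $p$, and for $k\ge 2$, $P_{p^k}=P_{p^{k-1}}\wr P_p=(P_{p^{k-1}})^{\times p}\rtimes P_p\le \mathfrak{S}_{p^k}$ (imprimitive action: the $p$ base factors act on $p$ disjoint blocks of size $p^{k-1}$ and $P_p$ permutes the blocks); this is a Sylow $p$-subgroup of $\mathfrak{S}_{p^k}$. Linear characters: for linear characters $\phi$ of $P_{p^{k-1}}$ and $\psi$ of $P_p$, $\mathcal{X}(\phi;\psi)$ is the linear character $(g_1,\dots,g_p;h)\mapsto\phi(g_1)\cdots\phi(g_p)\psi(h)$ of $P_{p^k}$. Recursively $\mathcal{X}(\phi_1)=\phi_1$ and $\mathcal{X}(\phi_1,\dots,\phi_k)=\mathcal{X}(\mathcal{X}(\phi_1,\dots,\phi_{k-1});\phi_k)$,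 for linear characters $\phi_i$ of $P_p$; every linear character of $P_{p^k}$ is uniquely of this form. For $\mathsf{u}\in\{0,1\}^k$, $\phi(\mathsf{u})$ denotes any linear character $\mathcal{X}(\psi_1,\dots,\psi_k)$ of $P_{p^k}$ such that, for each $j$, $\mathsf{u}_j=1$ if and only if $\psi_j$ is trivial (the claim holds for every such choice). $\Gamma_{l_1,\dots,l_b;k}(\mathsf{u}):=\sum_x \phi(\mathsf{u})(x)$, where $x$ runs over all elements of $P_{p^k}$ whose disjoint cycles have lengths $p^{l_1},\dots,p^{l_b}$ with all remaining points fixed; it is set to be $0$ if $p^{l_1}+\cdots+p^{l_b}>p^k$. For $l\in[k]$, $C_l(\mathsf{u}) := p^{\frac{p^l-1}{p-1}-2l}\cdot\prod_{m=1}^l(p\mathsf{u}_m-1)$. *)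

(* Defs.v *)
From HB Require Import structures.
From mathcomp Require Import all_boot all_order all_algebra.
From mathcomp Require Import all_fingroup all_solvable all_field all_character.

Set Implicit Arguments.
Unset Strict Implicit.
Unset Printing Implicit Defensive.

Import Order.TTheory GRing.Theory Num.Theory.
Local Open Scope ring_scope.

(* The p ^ k.+1 points form p consecutive blocks of size p ^ k; [point i r] is
   the r-th point of block i, and [block x], [pos x] are its two coordinates. *)
Section Wreath.

Variables p k : nat.

Lemma point_subproof (i : 'I_p) (r : 'I_(p ^ k)) :
  (i * p ^ k + r < p ^ k.+1)%N.
Proof.
rewrite expnS; apply: (@leq_trans (i.+1 * p ^ k)).
  by rewrite mulSn addnC ltn_add2r.
by rewrite leq_mul2r ltn_ord orbT.
Qed.

Lemma block_subproof (x : 'I_(p ^ k.+1)) : (x %/ p ^ k < p)%N.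
Proof.
have := ltn_ord x; rewrite {2}expnS.
case: (posnP (p ^ k)) => [->|pk_gt0]; first by rewrite muln0.
by rewrite ltn_divLR.
Qed.

Lemma pos_subproof (x : 'I_(p ^ k.+1)) : (x %% p ^ k < p ^ k)%N.
Proof.
rewrite ltn_mod lt0n; apply/eqP => pk0.
by have := ltn_ord x; rewrite {2}expnS pk0 muln0.
Qed.

Definition point (i : 'I_p) (r : 'I_(p ^ k)) : 'I_(p ^ k.+1) :=
  Ordinal (point_subproof i r).
Definition block (x : 'I_(p ^ k.+1)) : 'I_p := Ordinal (block_subproof x).
Definition pos (x : 'I_(p ^ k.+1)) : 'I_(p ^ k) := Ordinal (pos_subproof x).

Lemma blockK i r : block (point i r) = i.
Proof.
apply: val_inj => /=.
by rewrite divnMDl ?(leq_trans _ (ltn_ord r)) // divn_small ?addn0.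
Qed.

Lemma posK i r : pos (point i r) = r.
Proof. by apply: val_inj; rewrite /= modnMDl modn_small. Qed.

Lemma pointK x : point (block x) (pos x) = x.
Proof. by apply: val_inj; rewrite /= -divn_eq. Qed.

Lemma wr_subproof (g : {ffun 'I_p -> 'S_(p ^ k)}) (h : 'S_p) :
  injective (fun x => point (h (block x)) (g (block x) (pos x))).
Proof.
move=> x y eq_xy; rewrite -[x]pointK -[y]pointK.
have := congr1 block eq_xy; have := congr1 pos eq_xy.
rewrite !blockK !posK => eq_pos /perm_inj eq_block.
by move: eq_pos; rewrite eq_block => /perm_inj ->.
Qed.

(* (g_1, ..., g_p; h): each g_i acts on block i, then h permutes the blocks. *)
Definition wr (g : {ffun 'I_p -> 'S_(p ^ k)}) (h : 'S_p) : 'S_(p ^ k.+1) :=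
  perm (@wr_subproof g h).

Lemma wrE g h i r : wr g h (point i r) = point (h i) (g i r).
Proof. by rewrite permE blockK posK. Qed.

Lemma wrM g h g' h' :
  (wr g h * wr g' h')%g = wr [ffun i => (g i * g' (h i))%g] (h * h')%g.
Proof. by apply/permP => x; rewrite -[x]pointK permM !wrE ffunE !permM. Qed.

Lemma wr1 : wr [ffun=> 1%g] 1%g = 1%g.
Proof. by apply/permP => x; rewrite -[x]pointK wrE ffunE !perm1. Qed.

Lemma wr_inj g h g' h' :
  (0 < p ^ k)%N -> wr g h = wr g' h' -> (g, h) = (g', h').
Proof.
move=> pk_gt0 eq_wr.
have Eh i : h i = h' i.
  pose r := Ordinal pk_gt0.
  by have := congr1 block (congr1 (fun s : 'S__ => s (point i r)) eq_wr);
     rewrite /= !wrE !blockK.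
congr pair; last exact/permP.
apply/ffunP => i; apply/permP => r.
by have := congr1 pos (congr1 (fun s : 'S__ => s (point i r)) eq_wr);
   rewrite /= !wrE !posK.
Qed.

Variables (G : {group 'S_(p ^ k)}) (P : {group 'S_p}).

Definition wreath_set : {set 'S_(p ^ k.+1)} :=
  [set wr gh.1 gh.2 | gh : {ffun 'I_p -> 'S_(p ^ k)} * 'S_p
                    & [forall i, gh.1 i \in G] && (gh.2 \in P)].

Lemma wreathP x :
  reflect (exists (g : {ffun 'I_p -> 'S_(p ^ k)}) (h : 'S_p),
            [/\ forall i, g i \in G, h \in P & x = wr g h])
          (x \in wreath_set).
Proof.
apply: (iffP imsetP) => [[[g h]] | [g [h [gG hP ->]]]].
  by rewrite inE => /andP[/forallP gG hP] ->; exists g, h.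
by exists (g, h) => //; rewrite inE; apply/andP; split=> //; apply/forallP.
Qed.

Lemma wreath_group_set : group_set wreath_set.
Proof.
apply/group_setP; split=> [|x y].
  apply/wreathP; exists [ffun=> 1%g], 1%g; rewrite wr1.
  by split=> // i; rewrite ffunE.
move=> /wreathP[g [h [gG hP ->]]] /wreathP[g' [h' [g'G h'P ->]]].
apply/wreathP; rewrite wrM.
exists [ffun i => (g i * g' (h i))%g], (h * h')%g; split; rewrite ?groupM //.
by move=> i; rewrite ffunE groupM.
Qed.

Definition wreath : {group 'S_(p ^ k.+1)} := Group wreath_group_set.

(* The value phi(g_1) ... phi(g_p) psi(h) at the element (g_1, ..., g_p; h) of
   the wreath product, and 0 outside it; the decomposition is unique ([wr_inj]),
   so the choice made by [pick] is immaterial. *)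
Definition wr_char (phi : 'S_(p ^ k) -> algC) (psi : 'S_p -> algC)
    (x : 'S_(p ^ k.+1)) : algC :=
  if [pick gh : {ffun 'I_p -> 'S_(p ^ k)} * 'S_p |
       [forall i, gh.1 i \in G] && (gh.2 \in P) & x == wr gh.1 gh.2]
  is Some gh then (\prod_i phi (gh.1 i)) * psi gh.2 else 0.

Lemma wr_charE phi psi (g : {ffun 'I_p -> 'S_(p ^ k)}) h :
    (0 < p ^ k)%N -> (forall i, g i \in G) -> h \in P ->
  wr_char phi psi (wr g h) = (\prod_i phi (g i)) * psi h.
Proof.
move=> pk_gt0 gG hP; rewrite /wr_char; case: pickP => [[g' h'] | /(_ (g, h))].
  by case/andP=> _ /eqP/(wr_inj pk_gt0)[-> ->].
by rewrite /= hP eqxx !andbT; case/forallP.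
Qed.

End Wreath.

(* The recursion starts from the trivial group on p ^ 0 = 1 point: its wreath
   product with P is P itself ([sylow_tower1]). *)
Fixpoint sylow_tower (p : nat) (P : {group 'S_p}) (k : nat) :
    {group 'S_(p ^ k)} :=
  if k is k'.+1 then wreath (sylow_tower P k') P else 1%G.

Lemma sylow_tower1 (p : nat) (P : {group 'S_p}) :
  sylow_tower P 1 = P :> {set 'S_p}.
Proof.
have wr_id (g : {ffun 'I_p -> 'S_(p ^ 0)}) (h : 'S_p) :
  wr g h = h :> 'S_p.
  apply/permP => x; have := wrE g h (x : 'I_p) ord0.
  have -> : point (x : 'I_p) (ord0 : 'I_(p ^ 0)) = (x : 'I_(p ^ 1)).
    by apply: val_inj; rewrite /= muln1 addn0.
  move=> ->; apply: val_inj => /=.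
  by rewrite muln1 (ord1 (g x ord0 : 'I_1)) addn0.
apply/setP => x; apply/(@wreathP p 0 1%G P x)/idP => [[g [h [_ hP ->]]] | xP].
  by rewrite wr_id.
by exists [ffun=> 1%g], x; split=> // i; rewrite ffunE group1.
Qed.

(* X(psi_1; ...; psi_k), with [psi i] standing for psi_(i + 1). *)
Fixpoint tower_char (p : nat) (P : {group 'S_p}) (k : nat) :
    ('I_k -> 'CF(P)) -> 'S_(p ^ k) -> algC :=
  if k is k'.+1 then fun psi =>
    wr_char (sylow_tower P k') P
      (tower_char (fun i => psi (widen_ord (leqnSn k') i))) (psi ord_max)
  else fun _ _ => 1.

Lemma tower_charM (p : nat) (p_gt0 : (0 < p)%N) (P : {group 'S_p}) k
    (psi : 'I_k -> 'CF(P)) :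
  (forall j, psi j \is a linear_char) ->
  {in sylow_tower P k &, forall x y,
    tower_char psi (x * y)%g = tower_char psi x * tower_char psi y}.
Proof.
elim: k psi => [|k IH] psi lin_psi x y /=; first by rewrite mulr1.
have pk_gt0 : (0 < p ^ k)%N by rewrite expn_gt0 p_gt0.
move=> /wreathP[g [h [gG hP ->]]] /wreathP[g' [h' [g'G h'P ->]]].
rewrite wrM !wr_charE ?groupM //; last by move=> i; rewrite ffunE groupM.
rewrite lin_charM // mulrACA; congr (_ * _).
rewrite [X in _ = _ * X](reindex_inj (@perm_inj _ h)) -big_split /=.
by apply: eq_bigr => i _; rewrite ffunE IH.
Qed.

Lemma tower_char_lin (p : nat) (p_gt0 : (0 < p)%N) (P : {group 'S_p}) k
    (psi : 'I_k -> 'CF(P)) :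
  (forall j, psi j \is a linear_char) ->
  exists2 chi : 'CF(sylow_tower P k), chi \is a linear_char
     & {in sylow_tower P k, chi =1 tower_char psi}.
Proof.
move=> lin_psi.
have X1 : tower_char psi 1%g = 1.
  elim: k psi lin_psi => [|k IH] psi lin_psi //=.
  have pk_gt0 : (0 < p ^ k)%N by rewrite expn_gt0 p_gt0.
  rewrite -wr1 wr_charE // => [|i]; last by rewrite ffunE.
  rewrite lin_char1 // mulr1 big1 // => i _; rewrite ffunE IH //.
have repr_X : mx_repr (sylow_tower P k) (fun x => (tower_char psi x)%:M : 'M_1).
  by split=> [|x y xP yP]; rewrite ?X1 // tower_charM // scalar_mxM.
exists (cfRepr (MxRepresentation repr_X)).
  by rewrite qualifE /= cfRepr_char cfRepr1 eqxx.
by move=> x xP; rewrite cfunE xP mxtrace_scalar.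
Qed.

(* The nontrivial cycles of x have lengths [ls], counted with multiplicity. *)
Definition has_cycle_lengths (n : nat) (x : 'S_n) (ls : seq nat) : bool :=
  perm_eq [seq #|c| | c : {set 'I_n} <- enum (porbits x) & (1 < #|c|)%N] ls.

(* When p ^ l_1 + ... + p ^ l_b > p ^ k, no element has this cycle type and the
   sum is empty, so it takes the conventional value 0. *)
Definition Gamma (p : nat) (P : {group 'S_p}) (b : nat) (l : 'I_b -> nat)
    (k : nat) (phi : 'S_(p ^ k) -> algC) : algC :=
  \sum_(x in sylow_tower P k
        | has_cycle_lengths x [seq (p ^ l i)%N | i : 'I_b]) phi x.

(* [u i] stands for u_(i + 1).  The exponent may be negative, and the division
   by p - 1 in it is exact. *)
Definition Cfactor (p k : nat) (u : 'I_k -> bool) (l : nat) : algC :=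
  p%:R ^ (((p ^ l - 1) %/ (p - 1))%:Z - (2 * l)%:Z)
  * \prod_(m < k | (m < l)%N) (p%:R * (u m)%:R - 1).

(* [l i] stands for l_(i + 1), so the factor of index j is
   p^k - p^(l_b) - ... - p^(l_(j + 1)); differences are not truncated. *)
Definition Rfactor (p k b : nat) (l : 'I_b -> nat) : algC :=
  \prod_(j < b | (0 < j)%N)
    ((p ^ k)%:R - \sum_(i < b | (j <= i)%N) (p ^ l i)%:R).

(* Main.v *)
(* Induction on k, splitting the sum over x = (g_1, ..., g_p; h) according to h.
   - If h = 1, the cycles of x are those of the g_i, and as the lengths are
     distinct an element of the right type amounts to a distribution of the
     lengths over the p blocks.  The induction hypothesis then leaves the identity
     sum over distributions of prod_i falling(p^(k-1), lengths in block i)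
       = falling(p^k, all lengths),
     where falling(N, a_1 < ... < a_b) = prod_j (N - a_(j+1) - ... - a_b); it
     follows by choosing the block of the smallest length last.
   - If h <> 1, then x moves every point, so the lengths add up to p^k; being
     distinct powers of p, they reduce to the single length p^k.  Moreover x is a
     p^k-cycle iff its p-th power acts on a block as a p^(k-1)-cycle.  That return
     map is a product of all the g_i, so each of its values is taken
     |P_(p^(k-1))|^(p-1) times, and it carries the value phi(g_1) ... phi(g_p). *)
Require Import Defs.
From mathcomp Require Import all_boot all_order all_algebra.
From mathcomp Require Import all_fingroup all_solvable all_field all_character.
From mathcomp Require Import ring.

Import Order.TTheory GRing.Theory Num.Theory.
Local Open Scope ring_scope.

Set Implicit Arguments.
Unset Strict Implicit.
Unset Printing Implicit Defensive.

(** * Distributing a list over p blocks *)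

Section Words.

Variables (R : comNzRingType) (p : nat).

Fixpoint words (n : nat) : seq (seq 'I_p) :=
  if n is n'.+1 then [seq i :: w | i <- enum 'I_p, w <- words n'] else [:: [::]].

(* A word w of length [size s] sends the j-th entry of s to block [w_j];
   [part i w s] lists what block i receives. *)
Definition part (i : 'I_p) (w : seq 'I_p) (s : seq nat) : seq nat :=
  mask [seq j == i | j <- w] s.

Lemma part_cons i j w a s :
  part i (j :: w) (a :: s) = nseq (j == i) a ++ part i w s.
Proof. by rewrite /part map_cons mask_cons. Qed.

Lemma size_words n w : w \in words n -> size w = n.
Proof.
elim: n w => [|n IH] w /=; first by rewrite inE => /eqP->.
by case/allpairsP=> -[i w'] [_ /IH /= <- ->].
Qed.

Lemma big_part (V : Type) (idx : V) (op : Monoid.com_law idx) (F : nat -> V) w s :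
    size w = size s ->
  \big[op/idx]_i \big[op/idx]_(a <- part i w s) F a = \big[op/idx]_(a <- s) F a.
Proof.
elim: s w => [|a s IH] [|j w] //= => [_|[/IH eq_s]].
  by rewrite big_nil big1 // => i _; rewrite [part _ _ _]mask0 big_nil.
rewrite big_cons -eq_s (bigD1 j) //= [in RHS](bigD1 j) //= Monoid.mulmA.
rewrite part_cons eqxx big_cons; congr (op _ _).
by apply: eq_bigr => i /negPf nij; rewrite part_cons eq_sym nij.
Qed.

Lemma sum_part w s : size w = size s -> (\sum_i sumn (part i w s) = sumn s)%N.
Proof.
by move=> sz_w; under eq_bigr do rewrite sumnE; rewrite big_part // sumnE.
Qed.

Definition falling (N : R) (s : seq nat) : R :=
  \prod_(j < size s) (N - (sumn (drop j.+1 s))%:R).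

Lemma falling_cons N a s :
  falling N (a :: s) = (N - (sumn s)%:R) * falling N s.
Proof. by rewrite /falling /= big_ord_recl /= drop0. Qed.

Lemma sum_words_falling N s :
  \sum_(w <- words (size s)) \prod_i falling N (part i w s)
  = falling (p%:R * N) s.
Proof.
elim: s => [|a s IH] /=.
  by rewrite big_seq1 /falling big1 ?big_ord0 // => i _; rewrite big_ord0.
rewrite big_allpairs_dep big_enum /= exchange_big /= falling_cons -IH big_distrr /=.
apply: eq_big_seq => w /size_words sz_w.
transitivity (\sum_(j < p) (N - (sumn (part j w s))%:R)
                * \prod_i falling N (part i w s)).
  apply: eq_bigr => j _; rewrite (bigD1 j) //= part_cons eqxx falling_cons -mulrA.
  congr (_ * _); rewrite [RHS](bigD1 j) //=; congr (_ * _).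
  by apply: eq_bigr => i /negPf nij; rewrite part_cons eq_sym nij.
rewrite -big_distrl /= sumrB sumr_const card_ord mulr_natl -natr_sum.
by rewrite sum_part.
Qed.

Lemma count_big_cat (a : pred nat) (c : 'I_p -> seq nat) :
  count a (\big[cat/[::]]_i c i) = (\sum_i count a (c i))%N.
Proof. by apply: big_morph => // s t; rewrite count_cat. Qed.

Lemma mem_big_cat (a : nat) (c : 'I_p -> seq nat) :
  (a \in \big[cat/[::]]_i c i) = [exists i, a \in c i].
Proof.
rewrite -has_pred1 has_count count_big_cat lt0n sum_nat_eq0 negb_forall.
by apply: eq_existsb => i; rewrite /= -lt0n -has_count has_pred1.
Qed.

Lemma perm_big_cat_words (c : 'I_p -> seq nat) s : uniq s ->
  (perm_eq (\big[cat/[::]]_i c i) s)%:R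
  = \sum_(w <- words (size s)) \prod_i (perm_eq (c i) (part i w s))%:R :> R.
Proof.
elim: s c => [|a s IH] c /=.
  rewrite big_seq1 => _; have [all0|] := boolP [forall i, perm_eq (c i) [::]].
    rewrite [\big[cat/[::]]_i _]big1 => [|i _]; last first.
      by apply: perm_nilP; rewrite (forallP all0).
    by rewrite big1 // => i _; rewrite [part _ _ _]mask0 (forallP all0).
  rewrite negb_forall => /existsP[i nil_i].
  rewrite (bigD1 i) //= [part _ _ _]mask0 (negPf nil_i) mul0r.
  case: perm_nilP => // c0; case/negP: nil_i; apply/perm_nilP.
  case E : (c i) => [|x t] //; have : x \in \big[cat/[::]]_i c i.
    by rewrite mem_big_cat; apply/existsP; exists i; rewrite E mem_head.
  by rewrite c0.
case/andP=> as_ us; rewrite big_allpairs_dep big_enum /=.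
have [|] := boolP (a \in \big[cat/[::]]_i c i); rewrite mem_big_cat; last first.
  move=> a_c; case: (boolP (perm_eq _ (a :: s))) => [/perm_mem/(_ a)|_].
    by rewrite mem_head mem_big_cat (negPf a_c).
  rewrite big1 // => j _; rewrite big1 // => w _.
  rewrite (bigD1 j) //= part_cons eqxx; case: (boolP (perm_eq _ _)) => [/perm_mem/(_ a)|].
    by rewrite mem_head => acj; case/existsP: a_c; exists j.
  by rewrite mul0r.
case/existsP=> i0 a_i0; rewrite (bigD1 i0) //= [X in _ + X]big1 => [|j nj]; last first.
  rewrite big1 // => w _; rewrite (bigD1 i0) //= part_cons (negPf nj) /=.
  case: (boolP (perm_eq _ _)) => [/perm_mem/(_ a)|]; last by rewrite mul0r.
  by rewrite a_i0 => /esym/mem_mask; rewrite (negPf as_).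
pose c' i := if i == i0 then rem a (c i) else c i.
have -> : perm_eq (\big[cat/[::]]_i c i) (a :: s) = perm_eq (\big[cat/[::]]_i c' i) s.
  rewrite -(perm_cons a (\big[cat/[::]]_i c' i)); apply: permPl; apply/seq.permP => f.
  rewrite /= !count_big_cat (bigD1 i0) //= [in RHS](bigD1 i0) //= addnA.
  congr (_ + _)%N; last by apply: eq_bigr => i /negPf ni; rewrite /c' ni.
  by rewrite /c' eqxx (seq.permP (perm_to_rem a_i0)).
rewrite IH // addr0; apply: eq_bigr => w _; apply: eq_bigr => i _.
rewrite part_cons /c'; case: (eqVneq i0 i) => [<-|//].
by rewrite (permPl (perm_to_rem a_i0)) /= perm_cons.
Qed.

End Words.

(** * Cycle types in the wreath product *)

Section CycleLengths.

Definition cycle_lengths (n : nat) (x : 'S_n) : seq nat :=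
  [seq #|c| | c : {set 'I_n} <- enum (porbits x) & (1 < #|c|)%N].

Lemma count_cycle_lengths n (x : 'S_n) (a : pred nat) :
  count a (cycle_lengths x)
  = (\sum_(c in porbits x) ((1 < #|c|) && a #|c|))%N.
Proof.
rewrite count_map -sum1_count big_filter_cond big_enum_cond big_mkcondr.
by [].
Qed.

Lemma sum_card_porbits n (x : 'S_n) : (\sum_(c in porbits x) #|c|)%N = n.
Proof.
rewrite -[RHS](card_ord n) -[RHS]sum1_card.
rewrite (partition_big (porbit x) (mem (porbits x))) /= => [|r _]; last exact: imset_f.
apply: eq_bigr => c /imsetP[r _ ->]; rewrite -sum1_card; apply: eq_bigl => s.
by rewrite eq_porbit_mem.
Qed.

Lemma sumn_cycle_lengthsE n (x : 'S_n) :
  sumn (cycle_lengths x) = (\sum_(c in porbits x | (1 < #|c|)%N) #|c|)%N.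
Proof. by rewrite sumnE big_map big_filter big_enum_cond. Qed.

Lemma sumn_cycle_lengths_le n (x : 'S_n) : (sumn (cycle_lengths x) <= n)%N.
Proof.
rewrite sumn_cycle_lengthsE -[leqRHS](sum_card_porbits x).
by rewrite [leqRHS](bigID (fun c : {set 'I_n} => (1 < #|c|)%N)) leq_addr.
Qed.

Lemma sumn_cycle_lengths n (x : 'S_n) :
  (forall r, x r != r) -> sumn (cycle_lengths x) = n.
Proof.
move=> fixfree; rewrite sumn_cycle_lengthsE -[RHS](sum_card_porbits x).
rewrite [RHS](bigID (fun c : {set 'I_n} => (1 < #|c|)%N)) /= [X in (_ + X)%N]big1 ?addn0 //.
move=> c /andP[/imsetP[r _ ->]] /negP[]; apply/card_gt1P.
exists (x r), r; rewrite porbit_id fixfree; split=> //.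
by have := mem_porbit x 1 r; rewrite expg1.
Qed.

Lemma full_cycleP n (x : 'S_n) r : (1 < n)%N ->
  perm_eq (cycle_lengths x) [:: n] = (porbit x r == [set: 'I_n]).
Proof.
move=> n_gt1; apply/idP/eqP => [/perm_mem/(_ n) | full_r].
  rewrite inE eqxx => /mapP[c]; rewrite mem_filter mem_enum => /andP[_ /imsetP[s _ ->]].
  move=> /esym n_c; have full_s: porbit x s = [set: 'I_n].
    by apply/eqP; rewrite eqEcard subsetT cardsT card_ord n_c leqnn.
  by rewrite -full_s; apply/eqP; rewrite eq_porbit_mem full_s inE.
have porbits_x : porbits x = [set [set: 'I_n]].
  apply/setP => c; rewrite inE; apply/imsetP/eqP => [[s _ ->]|->]; last by exists r.
  by rewrite -full_r; apply/eqP; rewrite eq_porbit_mem full_r inE.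
by rewrite /cycle_lengths porbits_x enum_set1 /= cardsT card_ord n_gt1 /= cardsT card_ord.
Qed.

End CycleLengths.

Section WreathCycles.

Variables p k : nat.
Implicit Types (g : {ffun 'I_p -> 'S_(p ^ k)}) (h : 'S_p).

Lemma point_inj i : injective (@point p k i).
Proof. by move=> r s /(congr1 (@pos p k)); rewrite !posK. Qed.

Lemma wrX g h n i r :
  (wr g h ^+ n)%g (point i r)
  = point ((h ^+ n)%g i) ((\prod_(j < n) g ((h ^+ j) i))%g r).
Proof.
elim: n => [|n IH]; first by rewrite !expg0 big_ord0 !perm1.
by rewrite !expgSr big_ord_recr /= !permM IH wrE.
Qed.

Lemma wr1X g n i r : (wr g 1 ^+ n)%g (point i r) = point i ((g i ^+ n)%g r).
Proof.
elim: n => [|n IH]; first by rewrite !expg0 !perm1.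
by rewrite !expgSr !permM IH wrE perm1.
Qed.

Lemma porbit_wr1 g i r :
  porbit (wr g 1) (point i r) = [set point i s | s in porbit (g i) r].
Proof.
apply/setP => x; apply/porbitP/imsetP => [[n ->] | [s /porbitP[n ->] ->]].
  by exists ((g i ^+ n)%g r); rewrite ?mem_porbit ?wr1X.
by exists n; rewrite wr1X.
Qed.

Lemma porbits_wr1 g :
  porbits (wr g 1)
  = [set [set point ic.1 s | s in ic.2]
      | ic : 'I_p * {set 'I_(p ^ k)} in [set ic : 'I_p * {set 'I_(p ^ k)} | ic.2 \in porbits (g ic.1)]].
Proof.
apply/setP => c; apply/imsetP/imsetP => [[x _ ->] | [[i c']]].
  rewrite -[x]pointK porbit_wr1; exists (block x, porbit (g (block x)) (pos x)) => //.
  by rewrite inE /= imset_f.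
by rewrite inE /= => /imsetP[r _ ->] ->; exists (point i r); rewrite ?porbit_wr1.
Qed.

Lemma cycle_lengths_wr1 g :
  perm_eq (cycle_lengths (wr g 1)) (\big[cat/[::]]_i cycle_lengths (g i)).
Proof.
apply/seq.permP => a; rewrite count_big_cat count_cycle_lengths porbits_wr1.
rewrite big_imset /= => [|[i c] [j d]]; last first.
  rewrite !inE /= => /imsetP[r _ ->] /imsetP[s _ ->] eq_c.
  have : point i r \in [set point j t | t in porbit (g j) s].
    by rewrite -eq_c imset_f ?porbit_id.
  case/imsetP => t _ /(congr1 (@block p k)); rewrite !blockK => eq_ij.
  by move: eq_c; rewrite eq_ij => /imset_inj-> //; exact: point_inj.
under eq_bigl => ic do rewrite inE.
under eq_bigr => ic _ do rewrite (card_imset _ (@point_inj _)).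
under [RHS]eq_bigr => i _ do rewrite count_cycle_lengths.
by rewrite pair_big_dep.
Qed.

Variables (p_pr : prime p) (P : {group 'S_p}) (card_P : #|P| = p).
Variable h : 'S_p.
Hypotheses (hP : h \in P) (h_neq1 : h != 1%g).

Lemma order_top : #[h]%g = p.
Proof.
have := order_dvdG hP; rewrite card_P.
have [_ dvdp] := primeP p_pr; move/dvdp; rewrite order_eq1 (negPf h_neq1).
by move/eqP.
Qed.

Lemma porbit_top i : porbit h i = [set: 'I_p].
Proof.
have [i0 h_i0] : exists i0, h i0 != i0.
  apply/existsP; apply: contraR h_neq1; rewrite negb_exists => /forallP fix_h.
  by apply/eqP/permP => j; rewrite perm1; apply/eqP/negPn/fix_h.
have full_i0 : porbit h i0 = [set: 'I_p].
  have := dvdn_orbit 'P <[h]> i0; rewrite -porbitE -orderE order_top.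
  have [_ dvdp] := primeP p_pr; move/dvdp => /orP[/eqP card1|/eqP cardp].
    have /card_le1_eqP eq1 : (#|porbit h i0| <= 1)%N by rewrite card1.
    case/eqP: h_i0; apply: eq1; rewrite ?porbit_id //.
    by have := mem_porbit h 1 i0; rewrite expg1.
  by apply/eqP; rewrite eqEcard subsetT cardsT card_ord cardp leqnn.
by rewrite -full_i0; apply/eqP; rewrite eq_porbit_mem full_i0 inE.
Qed.

Lemma topX_fix n i : (h ^+ n)%g i = i -> (p %| n)%N.
Proof.
move=> fix_i; rewrite -order_top order_dvdn; apply/eqP/permP => j.
have : j \in porbit h i by rewrite porbit_top inE.
by case/porbitP=> m ->; rewrite perm1 -permM -expgD addnC expgD permM fix_i.
Qed.

Lemma top_fixfree i : h i != i.
Proof.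
apply/eqP => fix_i; have := @topX_fix 1 i; rewrite expg1 => /(_ fix_i).
by rewrite dvdn1 => /eqP p1; move: p_pr; rewrite p1.
Qed.

Lemma wr_fixfree g r : wr g h r != r.
Proof.
rewrite -[r]pointK wrE; apply/eqP => /(congr1 (@block p k)); rewrite !blockK.
by apply/eqP/top_fixfree.
Qed.

(* The first-return map of [wr g h] to block i. *)
Definition return_map g i : 'S_(p ^ k) := (\prod_(j < p) g ((h ^+ j) i))%g.

Lemma wrXp g q i r :
  (wr g h ^+ (p * q))%g (point i r) = point i ((return_map g i ^+ q)%g r).
Proof.
elim: q => [|q IH]; first by rewrite muln0 !expg0 !perm1.
rewrite mulnS addnC expgD expgSr !permM IH wrX.
by have := expg_order h; rewrite order_top => ->; rewrite perm1.
Qed.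

Lemma porbit_wr_full g i r :
  (porbit (wr g h) (point i r) == setT) = (porbit (return_map g i) r == setT).
Proof.
apply/eqP/eqP => full; apply/setP => s; rewrite inE.
  have : point i s \in porbit (wr g h) (point i r) by rewrite full inE.
  case/porbitP=> n s_n; have : (p %| n)%N.
    apply: (@topX_fix _ i); have := congr1 (@block p k) s_n.
    by rewrite wrX !blockK.
  case/dvdnP=> q def_n; move: s_n; rewrite def_n mulnC wrXp => /point_inj->.
  exact: mem_porbit.
have : block s \in porbit h i by rewrite porbit_top inE.
case/porbitP=> t block_s.
have [s' ->] : exists s', s = (wr g h ^+ t)%g (point i s').
  exists (((\prod_(j < t) g ((h ^+ j) i))^-1)%g (pos s)).
  by rewrite wrX -permM mulVg perm1 -block_s pointK.
have : s' \in porbit (return_map g i) r by rewrite full inE.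
case/porbitP=> q ->; rewrite -wrXp -permM -expgD; exact: mem_porbit.
Qed.

End WreathCycles.

(** * Character sums over the wreath product *)

Section WreathSums.

Variables (p k : nat) (G : {group 'S_(p ^ k)}) (P : {group 'S_p}).
Hypothesis pk_gt0 : (0 < p ^ k)%N.

Lemma big_wreath (V : Type) (idx : V) (op : Monoid.com_law idx) F :
  \big[op/idx]_(x in wreath G P) F x
  = \big[op/idx]_(h in P) \big[op/idx]_(g in ffun_on G) F (wr g h).
Proof.
rewrite big_imset /= => [|[g h] [g' h'] _ _]; last exact: wr_inj.
rewrite exchange_big pair_big_dep /=; apply: eq_bigl => -[g h].
rewrite !inE /=; congr (_ && _); apply/forallP/ffun_onP => //.
Qed.

Lemma card_wreath : #|wreath G P| = (#|G| ^ p * #|P|)%N.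
Proof.
rewrite -sum1_card big_wreath; under eq_bigr do rewrite sum1_card card_ffun_on card_ord.
by rewrite sum_nat_const mulnC.
Qed.

End WreathSums.

Lemma sum_lin_char (gT : finGroupType) (G : {group gT}) (psi : 'CF(G)) :
  psi \is a linear_char -> \sum_(x in G) psi x = (#|G| * (psi == 1))%:R.
Proof.
move=> psi_lin; have [->|psi_neq1] := eqVneq psi 1.
  rewrite muln1 -sum1_card natr_sum; apply: eq_bigr => x xG.
  by rewrite cfun1E xG.
rewrite muln0; have [x xG psi_x] : exists2 x, x \in G & psi x != 1.
  apply/exists_inP; apply: contraR psi_neq1; rewrite negb_exists_in.
  move=> /forall_inP psi1; apply/eqP/cfun_inP => x xG; rewrite cfun1E xG.
  by apply/eqP/negPn/psi1.
set S := \sum_(_ in _) _; have : psi x * S = S.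
  rewrite /S mulr_sumr [RHS](reindex_inj (mulgI x)) /=.
  apply: eq_big => y; first by rewrite groupMl.
  by move=> yG; rewrite lin_charM.
move/eqP; rewrite -subr_eq0 -[X in _ - X]mul1r -mulrBl mulf_eq0 subr_eq0.
by rewrite (negPf psi_x) => /eqP.
Qed.

Section FullCycles.

Variables (p k : nat) (p_pr : prime p) (G : {group 'S_(p ^ k)}) (P : {group 'S_p}).
Hypothesis card_P : #|P| = p.
Variables (chi : 'CF(G)) (psi : 'CF(P)).
Hypotheses (chi_lin : chi \is a linear_char) (psi_lin : psi \is a linear_char).

Let p_gt0 : (0 < p)%N := prime_gt0 p_pr.
Let pk_gt0 : (0 < p ^ k)%N.
Proof. by rewrite expn_gt0 p_gt0. Qed.

Lemma lin_char_return_map (g : {ffun 'I_p -> 'S_(p ^ k)}) h i :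
    h \in P -> h != 1%g -> (forall j, g j \in G) ->
  chi (return_map h g i) = \prod_j chi (g j).
Proof.
move=> hP h_neq1 gG; rewrite /return_map.
have hX_inj : injective (fun j : 'I_p => (h ^+ j)%g i).
  move=> j j' eq_hX; apply: val_inj => /=.
  wlog le_jj : j j' eq_hX / (j <= j')%N.
    by move=> IH; case/orP: (leq_total j j') => /IH ->.
  have fix_i : (h ^+ (j' - j))%g i = i.
    by apply: (@perm_inj _ (h ^+ j)%g); rewrite -permM -expgD subnK.
  have /(dvdn_leq _) := topX_fix p_pr card_P hP h_neq1 fix_i.
  case: (posnP (j' - j)) => [/eqP|_ /(_ isT)]; last first.
    by rewrite leqNgt (leq_ltn_trans (leq_subr _ _)).
  by rewrite subn_eq0 => le_j'j _; apply/eqP; rewrite eqn_leq le_jj.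
rewrite [RHS](reindex_inj hX_inj) /=.
have prodG n : (\prod_(j < n) g ((h ^+ j) i))%g \in G by apply: group_prod.
have chiM n : chi (\prod_(j < n) g ((h ^+ j) i))%g = \prod_(j < n) chi (g ((h ^+ j) i)%g).
  elim: n => [|n IH]; first by rewrite !big_ord0 lin_char1.
  by rewrite !big_ord_recr /= lin_charM ?prodG // IH.
exact: chiM.
Qed.

Lemma sum_return_map (W : 'S_(p ^ k) -> algC) h i :
    h \in P -> h != 1%g ->
  \sum_(g in ffun_on G) W (return_map h g i)
  = (#|G| ^ p.-1)%:R * \sum_(y in G) W y.
Proof.
move=> hP h_neq1.
have G_neq0 : #|G|%:R != 0 :> algC by rewrite pnatr_eq0 -lt0n cardG_gt0.
apply: (mulfI G_neq0); rewrite mulrA -natrM -expnS prednK //.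
pose shift c (g : {ffun 'I_p -> 'S_(p ^ k)}) :=
  [ffun j => if j == i then (c * g j)%g else g j].
have shift_inj c : injective (shift c).
  move=> g g' /ffunP eq_g; apply/ffunP => j; have := eq_g j; rewrite !ffunE.
  by case: eqP => // _ /mulgI.
have return_shift c g : return_map h (shift c g) i = (c * return_map h g i)%g.
  have shiftM m : (0 < m <= p)%N ->
      (\prod_(j < m) shift c g ((h ^+ j) i) = c * \prod_(j < m) g ((h ^+ j) i))%g.
    case: m => // m lt_m_p; rewrite !big_ord_recl /= !expg0 perm1 ffunE eqxx.
    rewrite mulgA; congr (_ * _)%g; apply: eq_bigr => j _; rewrite ffunE; case: eqP => //.
    move/(topX_fix p_pr card_P hP h_neq1)/dvdn_leq => /(_ isT).
    by rewrite leqNgt (leq_trans (ltn_ord j : j.+1 < m.+1)%N lt_m_p).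
  by apply: shiftM; rewrite p_gt0 leqnn.
(* Averaging over the translations g_i |-> c g_i, which multiply the return map
   by c on the left. *)
transitivity (\sum_(c in G) \sum_(g in ffun_on G) W (c * return_map h g i)%g).
  rewrite mulr_natl -sumr_const; apply: eq_bigr => c cG.
  rewrite (reindex_inj (shift_inj c)) /=; apply: eq_big => g; last by rewrite return_shift.
  apply/ffun_onP/ffun_onP => gG j; have := gG j; rewrite ffunE; case: eqP => // _.
    by rewrite groupMl.
  by rewrite groupMl.
rewrite exchange_big /=.
transitivity (\sum_(g : {ffun 'I_p -> 'S_(p ^ k)} | g \in ffun_on G) \sum_(y in G) W y); last first.
  by rewrite sumr_const card_ffun_on card_ord mulr_natl.
apply: eq_bigr => g /ffun_onP gG.
rewrite [RHS](reindex_inj (mulIg (return_map h g i))) /=; apply: eq_bigl => c.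
by rewrite groupMr //; apply: group_prod.
Qed.

Lemma sum_full_wreath i r :
  \sum_(x in wreath G P | porbit x (point i r) == setT) wr_char G P chi psi x
  = (p%:R * (psi == 1)%:R - 1) * (#|G| ^ p.-1)%:R
    * \sum_(y in G | porbit y r == setT) chi y.
Proof.
rewrite big_mkcondr big_wreath // (bigD1 1%g) //= [X in X + _]big1 => [|g /ffun_onP gG]; last first.
  rewrite porbit_wr1; case: eqP => // /(congr1 (fun A : {set _} => #|A|)).
  rewrite cardsT card_ord card_imset; last exact: point_inj.
  move=> eq_card; have := max_card (mem (porbit (g i) r)); rewrite eq_card card_ord expnS.
  by rewrite leqNgt ltn_Pmull // prime_gt1.
rewrite add0r [in RHS]big_mkcondr /=.
transitivity (\sum_(h in P | h != 1%g) psi h * ((#|G| ^ p.-1)%:R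
    * \sum_(y in G) if porbit y r == setT then chi y else 0)).
  apply: eq_bigr => h /andP[hP h_neq1].
  rewrite -(sum_return_map (fun y => if porbit y r == setT then chi y else 0) i hP h_neq1).
  rewrite mulr_sumr; apply: eq_bigr => g /ffun_onP gG.
  rewrite (porbit_wr_full p_pr card_P hP h_neq1) wr_charE //.
  rewrite (lin_char_return_map _ hP) //.
  by case: ifP; rewrite ?mulr0 // mulrC.
rewrite -mulr_suml -mulrA; congr (_ * _).
have := sum_lin_char psi_lin; rewrite card_P natrM (bigD1 1%g) //= lin_char1 // => <-.
by rewrite addrC addrK.
Qed.

End FullCycles.

(** * The Sylow tower *)

Section Tower.

Variables (p : nat) (p_pr : prime p) (P : {group 'S_p}) (card_P : #|P| = p).

Let p_gt0 : (0 < p)%N := prime_gt0 p_pr.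
Let p_gt1 : (1 < p)%N := prime_gt1 p_pr.
Let pX_gt0 k : (0 < p ^ k)%N.
Proof. by rewrite expn_gt0 p_gt0. Qed.

Lemma card_sylow_tower k : (#|sylow_tower P k| ^ p.-1 = p ^ (p ^ k).-1)%N.
Proof.
elim: k => [|k IH] /=; first by rewrite cards1 exp1n.
rewrite card_wreath // card_P expnMn -expnM mulnC [(p * _)%N]mulnC expnM IH.
rewrite -expnM -expnD; congr (p ^ _)%N; rewrite expnS.
by case: (p ^ k)%N (pX_gt0 k) => // n _; rewrite mulnS -[X in (X + _).-1](prednK p_gt0) mulnC.
Qed.

Lemma wr_char_tower k (psi : 'I_k -> 'CF(P)) (chi : 'CF(sylow_tower P k))
    (psi' : 'CF(P)) :
    {in sylow_tower P k, chi =1 tower_char psi} ->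
  {in wreath (sylow_tower P k) P,
     wr_char (sylow_tower P k) P (tower_char psi) psi'
     =1 wr_char (sylow_tower P k) P chi psi'}.
Proof.
move=> chiE x /wreathP[g [h [gG hP ->]]]; rewrite !wr_charE //.
by congr (_ * _); apply: eq_bigr => i _; rewrite chiE.
Qed.

Lemma sum_full_tower k (psi : 'I_k -> 'CF(P)) r :
    (forall j, psi j \is a linear_char) ->
  \sum_(x in sylow_tower P k | porbit x r == setT) tower_char psi x
  = \prod_(m < k) ((p%:R * (psi m == 1)%:R - 1) * (p ^ (p ^ m).-1)%:R).
Proof.
elim: k psi r => [|k IH] psi r psi_lin.
  rewrite big_ord0 /= (big_pred1 1%g) // => x; rewrite !inE andbC; case: eqP => //= -[].
  by apply/setP => s; rewrite inE (ord1 (s : 'I_1)) (ord1 (r : 'I_1)) porbit_id.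
pose psi' (i : 'I_k) := psi (widen_ord (leqnSn k) i).
have [chi chi_lin chiE] := tower_char_lin p_gt0 (fun j => psi_lin (widen_ord (leqnSn k) j)).
rewrite -[r]pointK big_ord_recr /= -(IH psi' (pos r)) // => [|j]; last exact: psi_lin.
under eq_bigr => x /andP[xW _] do rewrite (wr_char_tower _ chiE xW).
rewrite (sum_full_wreath p_pr card_P chi_lin (psi_lin ord_max)) card_sylow_tower mulrC.
by congr (_ * _); apply: eq_bigr => y /andP[/chiE].
Qed.

Definition cycle_sum k (phi : 'S_(p ^ k) -> algC) (ls : seq nat) : algC :=
  \sum_(x in sylow_tower P k | perm_eq (cycle_lengths x) ls) phi x.

Lemma cycle_sum_split k (psi : 'I_k.+1 -> 'CF(P)) ls :
    (forall j, psi j \is a linear_char) -> uniq ls -> sumn ls != (p ^ k.+1)%N ->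
  cycle_sum (tower_char psi) ls
  = \sum_(w <- words p (size ls)) \prod_i
      cycle_sum (tower_char (fun i => psi (widen_ord (leqnSn k) i))) (part i w ls).
Proof.
move=> psi_lin uniq_ls sum_ls; rewrite /cycle_sum big_mkcondr big_wreath //.
rewrite (bigD1 1%g) //= [X in _ + X]big1 ?addr0 => [|h /andP[hP h_neq1]]; last first.
  rewrite big1 // => g _; case: ifP => // /perm_sumn.
  rewrite sumn_cycle_lengths => [eq_sum|r]; first by rewrite eq_sum eqxx in sum_ls.
  exact: (wr_fixfree p_pr card_P hP h_neq1).
set phi := tower_char _.
transitivity (\sum_(g : {ffun 'I_p -> 'S_(p ^ k)} | g \in ffun_on (sylow_tower P k))
    \sum_(w <- words p (size ls)) \prod_i
      (if perm_eq (cycle_lengths (g i)) (part i w ls) then phi (g i) else 0)).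
  apply: eq_bigr => g /ffun_onP gG; rewrite wr_charE // lin_char1 // mulr1.
  rewrite (permPl (cycle_lengths_wr1 g)) -[LHS]mulrb -mulr_natr.
  rewrite (perm_big_cat_words algC _ uniq_ls) mulr_sumr; apply: eq_bigr => w _.
  rewrite -big_split /=; apply: eq_bigr => i _.
  by rewrite mulr_natr mulrb.
rewrite exchange_big /=; apply: eq_bigr => w _.
under [RHS]eq_bigr do rewrite big_mkcondr.
by rewrite bigA_distr_big.
Qed.

Lemma Cfactor_widen k (u : 'I_k.+1 -> bool) l : (l <= k)%N ->
  Cfactor p (fun i => u (widen_ord (leqnSn k) i)) l = Cfactor p u l.
Proof.
move=> le_lk; rewrite /Cfactor; congr (_ * _).
by rewrite [RHS]big_mkcond big_ord_recr /= ltnNge le_lk mulr1 -big_mkcond.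
Qed.

Lemma Cfactor_full k (u : 'I_k -> bool) :
  (p ^ k)%:R * Cfactor p u k
  = \prod_(m < k) ((p%:R * (u m)%:R - 1) * (p ^ (p ^ m).-1)%:R).
Proof.
have p_neq0 : p%:R != 0 :> algC by rewrite pnatr_eq0 -lt0n.
rewrite /Cfactor big_split /= mulrA mulrC; congr (_ * _).
  by apply: eq_bigl => m; rewrite ltn_ord.
under [RHS]eq_bigr do rewrite natrX.
rewrite -expr_sum natrX [X in X * _]exprnP -expfzDr // [RHS]exprnP.
congr (_ ^ _); rewrite !subn1 predn_exp mulKn; last by rewrite -subn1 subn_gt0.
have -> : (\sum_(i < k) p ^ i = \sum_(i < k) (p ^ i).-1 + k)%N.
  rewrite -[X in (_ + X)%N](card_ord k) -sum1_card -big_split /=.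
  by apply: eq_bigr => i _; rewrite addn1 prednK.
by rewrite PoszD mul2n -addnn PoszD; ring.
Qed.

Lemma sum_exp_lt n s :
  sorted ltn s -> all (ltn^~ n) s -> (sumn (map (expn p) s) < p ^ n)%N.
Proof.
elim: n s => [|n IH] s; first by case: s.
case/lastP: s => [|s a]; first by rewrite /= expn_gt0 p_gt0.
rewrite -cats1 map_cat sumn_cat /= addn0 cats1 all_rcons sorted_pairwise; last exact: ltn_trans.
rewrite pairwise_rcons -sorted_pairwise; last exact: ltn_trans.
case/andP=> lt_a sort_s /andP[]; rewrite ltnS => le_an _.
apply: leq_trans (_ : p ^ n + p ^ n <= _)%N; last by rewrite addnn -mul2n expnS leq_mul2r p_gt1 orbT.
rewrite -addSn leq_add ?leq_pexp2l //; apply: IH => //.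
by apply: sub_all lt_a => x /= lt_xa; apply: leq_trans le_an.
Qed.

Lemma falling_rcons0 (a : nat) (s : seq nat) :
  s != [::] -> falling a%:R (rcons s a) = 0 :> algC.
Proof.
elim: s => [|b s IH] // _; rewrite rcons_cons falling_cons.
have [->|/IH->] := eqVneq s [::]; last by rewrite mulr0.
by rewrite /= addn0 subrr mul0r.
Qed.

Lemma cycle_sum_tower k (psi : 'I_k -> 'CF(P)) (u : 'I_k -> bool) s :
    (forall j, psi j \is a linear_char) -> (forall j, u j = (psi j == 1)) ->
    sorted ltn s -> all (fun l => 1 <= l <= k)%N s ->
  cycle_sum (tower_char psi) (map (expn p) s)
  = (\prod_(l <- s) Cfactor p u l) * falling (p ^ k)%:R (map (expn p) s).
Proof.
elim: k psi u s => [|k IH] psi u s psi_lin u_psi sort_s le_s.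
  case: s sort_s le_s => [|l s] _ /=; last by case: l.
  rewrite big_nil /falling big_ord0 mulr1 /cycle_sum /= (big_pred1 1%g) // => x.
  rewrite !inE andbC; case: eqP => [->|]; last by rewrite andbF.
  rewrite andbT; apply/perm_nilP; rewrite /cycle_lengths.
  rewrite (@eq_filter _ _ pred0) ?filter_pred0 // => c /=.
  by apply/negbTE; rewrite -leqNgt (leq_trans (max_card _)) // card_ord.
have [all_s|] := boolP (all (fun l => 1 <= l <= k)%N s).
  have uniq_s : uniq (map (expn p) s).
    rewrite map_inj_uniq; last exact: expnI.
    by apply: sorted_uniq sort_s; [exact: ltn_trans | exact: ltnn].
  rewrite cycle_sum_split //; last first.
    rewrite neq_ltn sum_exp_lt //; apply: sub_all all_s => l /andP[_ le_lk].
    by rewrite /= ltnS.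
  rewrite expnS natrM -sum_words_falling mulr_sumr.
  apply: eq_big_seq => w /size_words; rewrite size_map => sz_w.
  rewrite -(big_part _ _ sz_w) -big_split /=; apply: eq_bigr => i _.
  have -> : part i w (map (expn p) s) = map (expn p) (part i w s) by rewrite map_mask.
  have all_w : all (fun l => 1 <= l <= k)%N (part i w s).
    by apply/allP => l /mem_mask /(allP all_s).
  rewrite (IH _ (fun i => u (widen_ord (leqnSn k) i))) //; last exact: sorted_mask ltn_trans _ _ _.
  congr (_ * _); apply: eq_big_seq => l /(allP all_w)/andP[_ le_lk].
  exact: Cfactor_widen.
case/lastP: s sort_s le_s => [|s a] //.
rewrite !all_rcons sorted_pairwise; last exact: ltn_trans.
rewrite pairwise_rcons => /andP[lt_sa sort_s].
move=> /andP[/andP[a_gt0 le_ak] le_s] not_le.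
have def_a : a = k.+1.
  apply/eqP; rewrite eqn_leq le_ak ltnNge; apply: contra not_le => le_ak'.
  rewrite a_gt0 le_ak'; apply/allP => l ls.
  have /andP[-> _] := allP le_s l ls.
  by rewrite (leq_trans (ltnW (allP lt_sa l ls))).
rewrite {a lt_sa a_gt0 le_ak not_le}def_a map_rcons.
have [->|s_neq0] := eqVneq s [::].
  rewrite big_seq1 /falling big_ord1 /= subr0 [RHS]mulrC Cfactor_full.
  pose r : 'I_(p ^ k.+1) := Ordinal (pX_gt0 k.+1).
  under [RHS]eq_bigr do rewrite u_psi.
  rewrite -(sum_full_tower r psi_lin); apply: eq_bigl => x.
  by rewrite (full_cycleP x r) // -[X in (X < _)%N](expn0 p) ltn_exp2l.
rewrite falling_rcons0 ?mulr0; last by case: s s_neq0 {sort_s le_s}.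
rewrite /cycle_sum big1 // => x /andP[_ /perm_sumn eq_sum].
have := sumn_cycle_lengths_le x; rewrite eq_sum -cats1 sumn_cat /= addn0.
rewrite -[X in (_ <= X)%N]add0n leq_add2r leqn0.
case: s s_neq0 {sort_s le_s eq_sum} => //= l s _.
by rewrite addn_eq0 -leqn0 leqNgt pX_gt0.
Qed.

End Tower.

Lemma sumn_drop (j : nat) (s : seq nat) :
  (sumn (drop j s) = \sum_(0 <= i < size s | j <= i) nth 0 s i)%N.
Proof.
elim: s j => [|a s IH] j; first by rewrite big_geq.
case: j => [|j] /=; rewrite big_mkcond big_nat_recl //=.
  by rewrite -(IH 0%N) drop0.
by rewrite add0n IH big_mkcond.
Qed.

Lemma falling_Rfactor (p k b : nat) (l : 'I_b -> nat) : (0 < b)%N ->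
  falling (p ^ k)%:R [seq (p ^ l i)%N | i : 'I_b] = (p ^ k)%:R * Rfactor p k l :> algC.
Proof.
move=> b_gt0; set s := [seq _ | i : 'I_b].
have sz_s : size s = b by rewrite size_map size_enum_ord.
have drop_s j : (sumn (drop j s))%:R = \sum_(i < b | (j <= i)%N) (p ^ l i)%:R :> algC.
  rewrite sumn_drop sz_s big_mkord natr_sum; apply: eq_bigr => i _.
  by rewrite (nth_map i) ?size_enum_ord // nth_ord_enum.
transitivity (\prod_(0 <= j < b) ((p ^ k)%:R - (sumn (drop j.+1 s))%:R) : algC).
  by rewrite -sz_s big_mkord.
transitivity ((p ^ k)%:R * \prod_(0 <= j < b | (0 < j)%N)
                             ((p ^ k)%:R - (sumn (drop j s))%:R) : algC); last first.
  by rewrite /Rfactor big_mkord; congr (_ * _); apply: eq_bigr => j _; rewrite drop_s.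
rewrite -{1}(prednK b_gt0) big_nat_recr //= prednK // -{2}sz_s drop_size subr0 mulrC.
congr (_ * _); rewrite -[in RHS](prednK b_gt0).
by rewrite [RHS]big_mkcond big_nat_recl //= mul1r.
Qed.

Theorem proposition4p9 (p : nat) (p_pr : prime p)
    (P : {group 'S_p}) (P_cyclic : cyclic P) (card_P : #|P| = p)
    (k b : nat) (b_bounds : (1 <= b <= p - 1)%N)
    (u : 'I_k -> bool)
    (psi : 'I_k -> 'CF(P))
    (psi_lin : forall j, psi j \is a linear_char)
    (psi_u : forall j, u j <-> psi j = 1)
    (l : 'I_b -> nat)
    (l_bounds : forall i, (1 <= l i <= k)%N)
    (l_incr : forall i j : 'I_b, (i < j)%N -> (l i < l j)%N) :
  Gamma P l (tower_char psi)
  = (p ^ k)%:R * (\prod_(i < b) Cfactor p u (l i)) * Rfactor p k l.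
Proof.
have [b_gt0 _] := andP b_bounds.
have u_psi j : u j = (psi j == 1) by apply/idP/eqP => /psi_u.
pose s := [seq l i | i : 'I_b].
have map_s : [seq (p ^ l i)%N | i : 'I_b] = map (expn p) s.
  by rewrite /s /image_mem -map_comp.
have sort_s : sorted ltn s.
  rewrite sorted_map; apply: (@sub_sorted _ (relpre val ltn)); first exact: l_incr.
  by rewrite -sorted_map val_enum_ord iota_ltn_sorted.
have le_s : all (fun l => 1 <= l <= k)%N s by apply/allP => _ /mapP[i _ ->].
have := cycle_sum_tower p_pr card_P psi_lin u_psi sort_s le_s.
rewrite -map_s (falling_Rfactor p k l b_gt0) big_map big_enum /= mulrA => eq_Gamma.
by rewrite [X in X * Rfactor _ _ _]mulrC -eq_Gamma.
Qed.
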